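(* Let $\mathsf G$ be a unimodular, second countable, type I locally compact group, let $\omega\in L^2(\mathsf G)$ and let $F\in\mathscr B^{\infty,\infty}(\mathscr X)$. Let $\mathsf{Tp}_\omega(F):=\mathfrak W_\omega\circ\mathsf{Ber}_\omega(F)\circ\mathfrak W_\omega^\dagger$, an operator in $\mathscr B^{2,2}(\mathscr X)$. Then $$\mathsf{Tp}_\omega(F)=\mathfrak P_\omega\circ\mathsf{Diag}_R(F)\circ\mathfrak P_\omega,$$ where $\mathfrak P_\omega=\mathfrak W_\omega\mathfrak W_\omega^\dagger$ and $\mathsf{Diag}_R(F)$ is the operator in the Hilbert space $\mathscr B^{2,2}(\mathscr X)$ of pointwise right multiplication by $F$, i.e. $[\mathsf{Diag}_R(F)H](X)=H(X)F(X)$.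
   Context: Setting. $\mathsf G$ is a unimodular, second countable, type I locally compact group with fixed Haar measure $\mathsf m$; $L^2(\mathsf G)=L^2(\mathsf G;\mathsf m)$ has norm $\|\cdot\|$ and scalar product $\langle\cdot,\cdot\rangle$, linear in the first variable. $\widehat{\mathsf G}$ is the unitary dual (unitary equivalence classes of irreducible strongly continuous unitary representations on complex separable Hilbert spaces) with the Mackey Borel structure. One fixes a measurable field of Hilbert spaces $\{\mathcal H_\xi\mid\xi\in\widehat{\mathsf G}\}$ and a measurable choice, for each $\xi\in\widehat{\mathsf G}$, of an irreducible representation of class $\xi$ on $\mathcal H_\xi$, denoted by the same letter $\xi:\mathsf G\to\mathbb B(\mathcal H_\xi)$. $\widehat{\mathsf m}$ is the Plancherel measure on $\widehat{\mathsf G}$, i.e. the measure for which the Fourier transform $(\mathscr Fu)(\xi)=\int_{\mathsf G}u(x)\xi(x)^*\,d\mathsf m(x)$ (weak sense, $u\in L^1\cap L^2$) extends to a unitary operator $L^2(\mathsf G)\to\mathscr B^2(\widehat{\mathsf G}):=\int^\oplus_{\widehat{\mathsf G}}\mathbb B^2(\mathcal H_\xi)\,d\widehat{\mathsf m}(\xi)$, where $\mathbb B^2$ denotes Hilbert–Schmidt operators. $\mathrm{Tr}_\xi$ is the usual trace on $\mathcal H_\xi$. Put $\mathscr X:=\widehat{\mathsf G}\times\mathsf G$, with points $X=(\xi,x)$ and product measure $d\mu(X)=d\widehat{\mathsf m}(\xi)\,d\mathsf m(x)$. Spaces. $\mathscr B^{2,2}(\mathscr X):=\mathscr B^2(\widehat{\mathsf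 G})\otimes L^2(\mathsf G)\cong L^2[\mathsf G;\mathscr B^2(\widehat{\mathsf G})]$, a Hilbert space with scalar product $\langle H_1,H_2\rangle=\int_{\mathscr X}\mathrm{Tr}_\xi[H_1(X)H_2(X)^*]\,d\mu(X)$. $\mathscr B^{\infty,\infty}(\mathscr X)$ is the von Neumann algebra of essentially bounded measurable fields $F$ with $F(\xi,x)\in\mathbb B(\mathcal H_\xi)$, with norm $\mathrm{ess\,sup}_{(\xi,x)}\|F(\xi,x)\|_{\mathbb B(\mathcal H_\xi)}$. Fourier–Wigner and Bargmann transformations. For $u,v\in L^2(\mathsf G)$ and $X=(\xi,x)\in\mathscr X$, $\mathfrak W_{u,v}(X)\in\mathbb B(\mathcal H_\xi)$ is the operator (integral in the weak sense) $$\mathfrak W_{u,v}(\xi,x)=\int_{\mathsf G}u(z)\,\overline{v(zx^{-1})}\,\xi(z)^*\,d\mathsf m(z).$$ It is known that $(u,v)\mapsto\mathfrak W_{u,v}$ defines a unitary operator $L^2(\mathsf G)\otimes\overline{L^2(\mathsf G)}\to\mathscr B^{2,2}(\mathscr X)$. The generalized Bargmann transformation associated to $\omega$ is the operator $\mathfrak W_\omega:L^2(\mathsf G)\to\mathscr B^{2,2}(\mathscr X)$, $\mathfrak W_\omega(u):=\mathfrak W_{u,\omega}$, and $\mathfrak W_\omega^\dagger$ is its Hilbert space adjoint. Berezin operators. For $F\in\mathscr B^{\infty,\infty}(\mathscr X)$, the bounded operator $\mathsf{Ber}_\omega(F)$ in $L^2(\mathsf G)$ is defined in the weak sense by $$\langle\mathsf{Ber}_\omega(F)u,v\rangle:=\int_{\mathscr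 X}\mathrm{Tr}_\xi\big[F(X)\,\mathfrak W_{v,\omega}(X)^*\,\mathfrak W_{u,\omega}(X)\big]\,d\mu(X),\qquad u,v\in L^2(\mathsf G).$$ *)

(* Defs.v *)
From HB Require Import structures.
From mathcomp Require Import all_boot all_order all_algebra.
From mathcomp Require Import all_classical all_reals all_analysis.
From mathcomp Require Import ess_sup_inf complex.

Set Implicit Arguments.
Unset Strict Implicit.
Unset Printing Implicit Defensive.
Import Order.TTheory GRing.Theory Num.Theory numFieldNormedType.Exports.

Local Open Scope classical_set_scope.
Local Open Scope ring_scope.
Local Open Scope complex_scope.
Local Open Scope quotient_scope.

HB.mixin Record isTopologicalGroup G of Group G & Topological G := {
  mulg_continuous : continuous (fun x : G * G => (x.1 * x.2)%g) ;
  invg_continuous : continuous (fun x : G => (x^-1)%g)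
}.

(* The point is only there because measurable types are pointed. *)
#[short(type="topologicalGroupType")]
HB.structure Definition TopologicalGroup :=
  {G of Group G & PointedTopological G & isTopologicalGroup G}.

Notation borel G := (g_sigma_algebraType (@open G)).

Section haar.
Variables (R : realType) (G : topologicalGroupType).

Definition lcsc_group :=
  [/\ hausdorff_space G, locally_compact [set: G] & @second_countable G].

(* Regularity is automatic on a second countable locally compact group. *)
Definition left_haar (m : {measure set (borel G) -> \bar R}) :=
  [/\ (forall (g : G) (A : set (borel G)), measurable A ->
         m ((fun x : G => (g * x)%g) @^-1` A) = m A),
      (forall K : set G, compact K -> (m K < +oo)%E) &
      (forall U : set G, open U -> U !=set0 -> (0 < m U)%E)].

Definition right_invariant (m : {measure set (borel G) -> \bar R}) :=
  forall (g : G) (A : set (borel G)), measurable A ->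
    m ((fun x : G => (x * g)%g) @^-1` A) = m A.

End haar.

HB.mixin Record CompleteNormedModule_isHilbert (R : realType) H
    of CompleteNormedModule R[i] H := {
  hdot : H -> H -> R[i] ;
  hdotPl : forall a (u v w : H), hdot (a *: u + v) w = a * hdot u w + hdot v w ;
  hdotC : forall u v : H, hdot v u = (hdot u v)^* ;
  hdot_norm : forall u : H, hdot u u = `|u| ^+ 2
}.

#[short(type="hilbertType")]
HB.structure Definition Hilbert (R : realType) :=
  {H of CompleteNormedModule R[i] H & CompleteNormedModule_isHilbert R H}.

Section operators.
Variables (R : realType) (H : hilbertType R).
Implicit Types (S T : H -> H) (u v : H).

Definition separable := exists e : nat -> H, closure (range e) = [set: H].

Definition bounded_op T := linear T /\ continuous T.

(* [`|v|] is an element of [R[i]], whose imaginary part is zero. *)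
Definition hnorm v : R := complex.Re `|v|.

Definition opnorm T : \bar R :=
  ereal_sup [set (hnorm (T v))%:E | v in [set v | hnorm v <= 1]].

(* By the Riesz theorem the adjoint of a bounded operator exists, and it is
   unique; the default value is not used. *)
Definition adj T : H -> H :=
  xget (fun=> 0) [set S | forall u v, hdot (T u) v = hdot u (S v)].

(* An orthonormal basis indexed by [nat]; when the dimension is finite, the
   sequence is completed by zero vectors. *)
Definition orthonormal_basis (b : nat -> H) :=
  [/\ (forall i j, i <> j -> hdot (b i) (b j) = 0),
      (forall i, `|b i| = 1 \/ b i = 0) &
      (forall v, (forall i, hdot v (b i) = 0) -> v = 0)].

(* On a separable space such a basis exists, and the trace of a trace class
   operator and the Hilbert-Schmidt norm do not depend on the one chosen. *)
Definition onb : nat -> H := xget (fun=> 0) orthonormal_basis.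

Definition trace T : R[i] :=
  limn (series (fun n => complex.Re (hdot (T (onb n)) (onb n)))) +i*
  limn (series (fun n => complex.Im (hdot (T (onb n)) (onb n)))).

Definition hsnorm2 T : \bar R :=
  (\sum_(0 <= n <oo) (hnorm (T (onb n)) ^+ 2)%:E)%E.

Definition hilbert_schmidt T := bounded_op T /\ (hsnorm2 T < +oo)%E.

End operators.

Section representations.
Variables (R : realType) (G : topologicalGroupType).

Record unirep (H : hilbertType R) := Unirep {
  rep_fun :> G -> H -> H ;
  rep_linear : forall x, linear (rep_fun x) ;
  rep1 : forall v, rep_fun 1%g v = v ;
  repM : forall x y v, rep_fun (x * y)%g v = rep_fun x (rep_fun y v) ;
  rep_unitary : forall x u v, hdot (rep_fun x u) (rep_fun x v) = hdot u v ;
  rep_continuous : forall v, continuous (fun x => rep_fun x v)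
}.

Definition irreducible (H : hilbertType R) (r : unirep H) :=
  (exists v : H, v <> 0) /\
  forall V : set H, closed V -> V 0 ->
    (forall a u v, V u -> V v -> V (a *: u + v)) ->
    (forall x v, V v -> V (r x v)) ->
    V = [set 0] \/ V = [set: H].

Definition isometric_intertwiner (H K : hilbertType R) (r : unirep H)
    (s : unirep K) (U : H -> K) :=
  [/\ linear U, (forall u v, hdot (U u) (U v) = hdot u v) &
      (forall x v, U (r x v) = s x (U v))].

Definition equivalent (H K : hilbertType R) (r : unirep H) (s : unirep K) :=
  exists U : H -> K, isometric_intertwiner r s U /\ range U = [set: K].

Definition commutant (H : hilbertType R) (r : unirep H) : set (H -> H) :=
  [set S | bounded_op S /\ forall x v, S (r x v) = r x (S v)].

(* The center of the commutant is that of the von Neumann algebra generated by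
   [r]. *)
Definition factor_rep (H : hilbertType R) (r : unirep H) :=
  forall S, commutant r S ->
    (forall T, commutant r T -> forall v, S (T v) = T (S v)) ->
    exists a : R[i], forall v, S v = a *: v.

Definition multiple_of (H K : hilbertType R) (r : unirep H) (s : unirep K) :=
  exists (I : Type) (U : I -> K -> H),
    [/\ (forall i, isometric_intertwiner s r (U i)),
        (forall i j, i <> j -> forall u v, hdot (U i u) (U j v) = 0) &
        (forall w, (forall i v, hdot w (U i v) = 0) -> w = 0)].

Definition type_I :=
  forall (H : hilbertType R) (r : unirep H), factor_rep r ->
    exists (K : hilbertType R) (s : unirep K), irreducible s /\ multiple_of r s.

Record irrep (H : hilbertType R) := Irrep {
  irrep_rep :> unirep H ;
  irrepP : irreducible irrep_rep
}.

End representations.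

Section unitary_dual.
Variables (R : realType) (G : topologicalGroupType).
Variables (D : Type) (sp : D -> hilbertType R).
Variable rep : forall xi, @unirep R G (sp xi).

(* [D] is identified with the set of equivalence classes through the
   representatives [rep xi]. *)
Definition is_unitary_dual :=
  (forall xi, separable (sp xi) /\ irreducible (rep xi)) /\
  (forall (H : hilbertType R) (r : unirep G H), separable H -> irreducible r ->
     exists! xi, equivalent r (rep xi)).

Definition mackey_generators (H : hilbertType R) : set (set (irrep G H)) :=
  [set P | exists (x : G) (u v : H) (B : set R), measurable B /\
     (P = [set r : irrep G H | B (complex.Re (hdot (r x u) v))] \/
      P = [set r : irrep G H | B (complex.Im (hdot (r x u) v))])].

(* The quotient Borel structure of the Borel structures of the spaces of
   irreducible representations on a fixed Hilbert space. It is enough to use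
   one space of each dimension; those of equal dimension give the same
   condition on [A]. *)
Definition mackey_measurable (A : set D) :=
  forall H : hilbertType R, separable H ->
    <<s @mackey_generators H >>
      [set r : irrep G H | exists2 xi, A xi & equivalent r (rep xi)].

End unitary_dual.

Section complex_integration.
Context d (T : measurableType d) (R : realType).
Variable mu : {measure set T -> \bar R}.

Definition cmeasurable (f : T -> R[i]) :=
  measurable_fun [set: T] (fun t => complex.Re (f t)) /\
  measurable_fun [set: T] (fun t => complex.Im (f t)).

Definition cintegral (f : T -> R[i]) : R[i] :=
  (\int[mu]_t complex.Re (f t)) +i* (\int[mu]_t complex.Im (f t)).

Record sqfun := SqFun {
  sqfun_fun :> T -> R[i] ;
  sqfun_meas : cmeasurable sqfun_fun ;
  sqfun_fin : (\int[mu]_t (Normc.normc (sqfun_fun t) ^+ 2)%:E < +oo)%E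
}.

HB.instance Definition _ := gen_eqMixin sqfun.
HB.instance Definition _ := gen_choiceMixin sqfun.

Definition sqfun_eq (f g : sqfun) : bool := `[< \forall t \ae mu, f t = g t >].

Lemma sqfun_eq_refl : reflexive sqfun_eq.
Proof. by move=> f; apply/asboolP; apply: aeW. Qed.

Lemma sqfun_eq_sym : symmetric sqfun_eq.
Proof.
by move=> f g; apply/idP/idP => /asboolP h; apply/asboolP; apply: filterS h.
Qed.

Lemma sqfun_eq_trans : transitive sqfun_eq.
Proof.
move=> g f h /asboolP fg /asboolP gh; apply/asboolP.
by apply: filterS2 fg gh => t -> ->.
Qed.

Canonical sqfun_equiv :=
  EquivRel sqfun_eq sqfun_eq_refl sqfun_eq_sym sqfun_eq_trans.

Definition L2 : Type := {eq_quot sqfun_eq}.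
HB.instance Definition _ := Choice.on L2.
HB.instance Definition _ := EqQuotient.on L2.

Definition L2_fun (u : L2) : T -> R[i] := repr u.
Coercion L2_fun : L2 >-> Funclass.

Definition L2_dot (u v : L2) : R[i] := cintegral (fun t => u t * (v t)^*).

Definition L1_fun (f : T -> R[i]) :=
  cmeasurable f /\ (\int[mu]_t (Normc.normc (f t))%:E < +oo)%E.

Lemma sqfun0_meas : cmeasurable (fun=> 0).
Proof. by split; exact: measurable_cst. Qed.

Lemma sqfun0_fin :
  (\int[mu]_t (Normc.normc ((fun=> 0 : R[i]) t) ^+ 2)%:E < +oo)%E.
Proof.
rewrite integral0_eq ?ltry// => t _.
by rewrite (Normc.normc0 R) expr0n.
Qed.

Definition L2_zero : L2 := \pi_L2 (SqFun sqfun0_meas sqfun0_fin).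

End complex_integration.

Section fields.
Context d (T : measurableType d) (R : realType).
Variables (sp : T -> hilbertType R) (e : nat -> forall t, sp t).

(* [e] is a fundamental sequence for the field [sp]. *)
Definition measurable_hilbert_field :=
  (forall m n, cmeasurable (fun t => hdot (e m t) (e n t))) /\
  (forall t (v : sp t), (forall n, hdot v (e n t) = 0) -> v = 0).

Definition measurable_vfield (f : forall t, sp t) :=
  forall n, cmeasurable (fun t => hdot (f t) (e n t)).

Definition measurable_opfield (A : forall t, sp t -> sp t) :=
  forall f, measurable_vfield f -> measurable_vfield (fun t => A t (f t)).

Variable mu : {measure set T -> \bar R}.

Definition ess_bounded_field (A : forall t, sp t -> sp t) :=
  [/\ (forall t, bounded_op (A t)), measurable_opfield A &
      (ess_sup mu (fun t => opnorm (A t)) < +oo)%E].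

Record hsfield := HSField {
  hsfield_fun :> forall t, sp t -> sp t ;
  hsfield_hs : forall t, hilbert_schmidt (@hsfield_fun t) ;
  hsfield_meas : measurable_opfield (@hsfield_fun) ;
  hsfield_fin : (\int[mu]_t hsnorm2 (@hsfield_fun t) < +oo)%E
}.
Arguments hsfield_fun : clear implicits.

HB.instance Definition _ := gen_eqMixin hsfield.
HB.instance Definition _ := gen_choiceMixin hsfield.

Definition hsfield_eq (A B : hsfield) : bool :=
  `[< \forall t \ae mu, A t = B t >].

Lemma hsfield_eq_refl : reflexive hsfield_eq.
Proof. by move=> f; apply/asboolP; apply: aeW. Qed.

Lemma hsfield_eq_sym : symmetric hsfield_eq.
Proof.
by move=> f g; apply/idP/idP => /asboolP h; apply/asboolP; apply: filterS h.
Qed.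

Lemma hsfield_eq_trans : transitive hsfield_eq.
Proof.
move=> g f h /asboolP fg /asboolP gh; apply/asboolP.
by apply: filterS2 fg gh => t -> ->.
Qed.

Canonical hsfield_equiv :=
  EquivRel hsfield_eq hsfield_eq_refl hsfield_eq_sym hsfield_eq_trans.

(* The direct integral of the spaces of Hilbert-Schmidt operators on [sp t],
   as square-integrable measurable fields modulo equality almost everywhere. *)
Definition HS2 : Type := {eq_quot hsfield_eq}.
HB.instance Definition _ := Choice.on HS2.
HB.instance Definition _ := EqQuotient.on HS2.

Definition HS2_fun (A : HS2) : forall t, sp t -> sp t := repr A.
Arguments HS2_fun : clear implicits.
Coercion HS2_fun : HS2 >-> Funclass.

Definition HS2_dot (A B : HS2) : R[i] :=
  cintegral mu (fun t => trace (A t \o adj (B t))).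

Lemma hdot0l (H : hilbertType R) (v : H) : hdot 0 v = 0.
Proof.
have := hdotPl 1 0 0 v.
by rewrite scale1r addr0 mul1r -[LHS]addr0 => /addrI/esym.
Qed.

Lemma hsnorm2_0 (H : hilbertType R) : hsnorm2 (fun=> 0 : H) = 0%E.
Proof.
rewrite /hsnorm2 eseries0// => n _ _.
by rewrite /hnorm normr0 /= expr0n.
Qed.

Lemma hsfield0_hs t : hilbert_schmidt (fun=> 0 : sp t).
Proof.
split; last by rewrite hsnorm2_0 ltry.
split; last by move=> x; exact: cvg_cst.
by move=> a u v; rewrite scaler0 addr0.
Qed.

Lemma hsfield0_meas : measurable_opfield (fun t => fun=> 0 : sp t).
Proof.
move=> f _ n; rewrite /cmeasurable.
under eq_fun do rewrite hdot0l.
under [X in _ /\ measurable_fun _ X]eq_fun do rewrite hdot0l.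
by split; exact: measurable_cst.
Qed.

Lemma hsfield0_fin : (\int[mu]_t hsnorm2 (fun=> 0%R : sp t) < +oo)%E.
Proof. by rewrite integral0_eq ?ltry// => t _; rewrite hsnorm2_0. Qed.

Definition HS2_zero : HS2 :=
  \pi_HS2 (HSField hsfield0_hs hsfield0_meas hsfield0_fin).

End fields.

Section plancherel.
Variables (R : realType) (G : topologicalGroupType).
Variable m : {measure set (borel G) -> \bar R}.
Context d (D : measurableType d) (sp : D -> hilbertType R).
Variables (rep : forall xi, @unirep R G (sp xi)) (e : nat -> forall xi, sp xi).

Definition is_fourier (u : borel G -> R[i]) (xi : D) (A : sp xi -> sp xi) :=
  forall a b : sp xi,
    hdot (A a) b = cintegral m (fun x => u x * hdot (adj (rep xi x) a) b).

(* A surjective map preserving the scalar products is linear, hence unitary. *)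
Definition is_plancherel (mhat : {measure set D -> \bar R}) :=
  exists U : L2 m -> HS2 e mhat,
    [/\ (forall u v, HS2_dot (U u) (U v) = L2_dot u v),
        (forall A, exists u, U u = A) &
        (forall u : L2 m, L1_fun m u ->
           \forall xi \ae mhat, is_fourier u (U u xi))].

End plancherel.

Section berezin.
Variables (R : realType) (G : topologicalGroupType).
Variable m : {sigma_finite_measure set (borel G) -> \bar R}.
Context d (D : measurableType d) (sp : D -> hilbertType R).
Variables (rep : forall xi, @unirep R G (sp xi)) (e : nat -> forall xi, sp xi).
Variable mhat : {sigma_finite_measure set D -> \bar R}.

(* [HS2 phase_seq phase_measure] is the tensor product of [HS2 e mhat] and
   [L2 m], i.e. the space of square-integrable functions on [G] with values in
   [HS2 e mhat], written as fields over the product. *)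
Definition phase_measure : {measure set (D * borel G) -> \bar R} :=
  (mhat \x m)%E.

Definition phase_sp (X : D * borel G) : hilbertType R := sp X.1.

Definition phase_seq (n : nat) (X : D * borel G) : phase_sp X := e n X.1.

Local Notation B22 := (HS2 phase_seq phase_measure).

Definition is_fourier_wigner (u v : borel G -> R[i]) (X : D * borel G)
    (A : phase_sp X -> phase_sp X) :=
  forall a b : sp X.1,
    hdot (A a) b =
    cintegral m (fun z => u z * (v ((z : G) * (X.2 : G)^-1)%g)^* *
                          hdot (adj (rep X.1 z) a) b).

(* The field [X |-> W_{u,v}(X)] as an element of the Hilbert space: its values
   are almost everywhere the operators given by the weak integral. By the
   Plancherel theorem there is exactly one such class. *)
Definition fourier_wigner (u v : L2 m) : B22 :=
  xget (HS2_zero phase_seq phase_measure)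
    [set W : B22 | \forall X \ae phase_measure, is_fourier_wigner u v (W X)].

Definition bargmann (w u : L2 m) : B22 := fourier_wigner u w.

Definition bargmann_adj (w : L2 m) : B22 -> L2 m :=
  xget (fun=> L2_zero m)
    [set S | forall (u : L2 m) (A : B22),
       HS2_dot (bargmann w u) A = L2_dot u (S A)].

Definition bargmann_proj (w : L2 m) : B22 -> B22 :=
  bargmann w \o bargmann_adj w.

(* The identity determines the operator, which is then linear and bounded. *)
Definition berezin (w : L2 m) (F : forall X : D * borel G, sp X.1 -> sp X.1) :
    L2 m -> L2 m :=
  xget (fun=> L2_zero m)
    [set B | forall u v : L2 m,
       L2_dot (B u) v =
       cintegral phase_measure (fun X =>
         trace (F X \o adj (fourier_wigner v w X) \o fourier_wigner u w X))].

Definition diagR (F : forall X : D * borel G, sp X.1 -> sp X.1) (A : B22) :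
    B22 :=
  xget (HS2_zero phase_seq phase_measure)
    [set B : B22 | \forall X \ae phase_measure, B X = A X \o F X].

Definition toeplitz (w : L2 m) (F : forall X : D * borel G, sp X.1 -> sp X.1) :
    B22 -> B22 :=
  bargmann w \o berezin w F \o bargmann_adj w.

End berezin.

Notation B22 m e mhat := (HS2 (phase_seq e) (phase_measure m mhat)).

(* Main.v *)
Require Import Defs.
From HB Require Import structures.
From mathcomp Require Import all_boot all_order all_algebra.
From mathcomp Require Import all_classical all_reals all_analysis.
From mathcomp Require Import ess_sup_inf complex.
From mathcomp Require Import measurable_realfun ring lra.

Set Implicit Arguments.
Unset Strict Implicit.
Unset Printing Implicit Defensive.
Import Order.TTheory GRing.Theory Num.Theory numFieldNormedType.Exports.

Local Open Scope classical_set_scope.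
Local Open Scope ring_scope.

(** If [W] denotes the Bargmann transformation and [S] its adjoint, then
    [S o Diag_R(F) o W] satisfies the identity defining the Berezin operator:
    the scalar product of [Diag_R(F) (W u)] with [W v] is the integral of
    [Tr (W u(X) F(X) adj(W v(X)))], which is [Tr (F(X) adj(W v(X)) W u(X))] by
    cyclicity of the trace. The identity determines the operator, so
    [Ber(F) = S o Diag_R(F) o W]; compose with [W] and [S].
    The existence of [S] need not be proved: without it [S] is by convention
    the constant [0], and both sides are the constant [W 0], because
    [Ber(F) 0 = 0]. Likewise no orthonormal basis has to be constructed: if
    there is none, [onb] is zero and so are all traces. *)

(** * A squeeze criterion; real and imaginary parts of complex numbers *)

Lemma cvg_dist_le (R : realType) (x h : nat -> R) (l : R) :
  (forall n, `|x n - l| <= h n) -> h @ \oo --> (0 : R) -> x @ \oo --> l.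
Proof.
move=> xh h0; apply/subr_cvg0; apply: norm_cvg0.
apply: (squeeze_cvgr (f := cst 0) (h := h)) => //; last exact: cvg_cst.
by apply: nearW => n; rewrite normr_ge0 /=.
Qed.

Section complex_parts.
Variable R : realType.
Implicit Types (x y : R[i]) (a : R).

Lemma complex_ReD x y : complex.Re (x + y) = complex.Re x + complex.Re y.
Proof. by case: x; case: y. Qed.

Lemma complex_ReN x : complex.Re (- x) = - complex.Re x.
Proof. by case: x. Qed.

Lemma complex_Re_conj x : complex.Re (conjc x) = complex.Re x.
Proof. by case: x. Qed.

Lemma complex_Re_rM a x : complex.Re (real_complex R a * x) = a * complex.Re x.
Proof. by case: x => u v /=; rewrite mul0r subr0. Qed.

(** Used to deduce claims about imaginary parts from the same claims about real parts, after scaling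
    by [-i]. *)
Lemma complex_Im_Re x : complex.Im x = complex.Re (- 'i%C * x).
Proof. by case: x => u v /=; ring. Qed.

Lemma normc_sqr x : Normc.normc x ^+ 2 = complex.Re (x * conjc x).
Proof.
case: x => u v /=; rewrite sqr_sqrtr; last by rewrite addr_ge0 ?sqr_ge0.
ring.
Qed.

Lemma normc_conj x : Normc.normc (conjc x) = Normc.normc x.
Proof. by case: x => u v /=; rewrite sqrrN. Qed.

Lemma mulc_conj x : x * conjc x = real_complex R (Normc.normc x ^+ 2).
Proof.
case: x => u v /=; rewrite sqr_sqrtr; last by rewrite addr_ge0 ?sqr_ge0.
by apply/eqP; rewrite eq_complex /=; apply/andP; split; apply/eqP; ring.
Qed.

End complex_parts.

(** * Scalar products, the Cauchy-Schwarz inequality and bounded operators *)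

Section hilbert_space.
Variables (R : realType) (H : hilbertType R).
Implicit Types (u v w : H) (T S : H -> H).

Lemma hdotDl u v w : hdot (u + v) w = hdot u w + hdot v w.
Proof. by have := hdotPl 1 u v w; rewrite scale1r mul1r. Qed.

Lemma hdotZl a u w : hdot (a *: u) w = a * hdot u w.
Proof. by have := hdotPl a u 0 w; rewrite addr0 hdot0l addr0. Qed.

Lemma hdotNl u w : hdot (- u) w = - hdot u w.
Proof. by rewrite -scaleN1r hdotZl mulN1r. Qed.

Lemma hdotBl u v w : hdot (u - v) w = hdot u w - hdot v w.
Proof. by rewrite hdotDl hdotNl. Qed.

Lemma hdotDr u v w : hdot u (v + w) = hdot u v + hdot u w.
Proof. by rewrite hdotC hdotDl rmorphD /= -!hdotC. Qed.

Lemma hdotZr a u w : hdot u (a *: w) = conjc a * hdot u w.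
Proof. by rewrite hdotC hdotZl rmorphM /= -hdotC. Qed.

Lemma hdotNr u w : hdot u (- w) = - hdot u w.
Proof. by rewrite hdotC hdotNl rmorphN /= -hdotC. Qed.

Lemma hdot0r u : hdot u 0 = 0.
Proof. by rewrite hdotC hdot0l rmorph0. Qed.

Lemma hdot_suml (I : Type) (r : seq I) (P : pred I) (f : I -> H) w :
  hdot (\sum_(i <- r | P i) f i) w = \sum_(i <- r | P i) hdot (f i) w.
Proof.
by apply: (big_morph (fun u => hdot u w)) => [u v|]; rewrite ?hdotDl ?hdot0l.
Qed.

Lemma hnormE v : `|v| = real_complex R (hnorm v).
Proof. by rewrite RRe_real// normr_real. Qed.

Lemma hdot_hnorm v : hdot v v = real_complex R (hnorm v ^+ 2).
Proof. by rewrite hdot_norm hnormE rmorphXn. Qed.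

Lemma hnorm_sqr v : hnorm v ^+ 2 = complex.Re (hdot v v).
Proof. by rewrite hdot_hnorm. Qed.

Lemma hnorm_ge0 v : 0 <= hnorm v.
Proof. by rewrite -ler0c -hnormE normr_ge0. Qed.

Lemma hnorm_eq0 v : hnorm v = 0 -> v = 0.
Proof. by move=> v0; apply: normr0_eq0; rewrite hnormE v0. Qed.

Lemma hnorm0 : hnorm (0 : H) = 0.
Proof. by rewrite /hnorm normr0. Qed.

Lemma hnormN v : hnorm (- v) = hnorm v.
Proof. by rewrite /hnorm normrN. Qed.

Lemma hnormB u v : hnorm (u - v) = hnorm (v - u).
Proof. by rewrite -hnormN opprB. Qed.

Lemma hnormZ a v : hnorm (a *: v) = Normc.normc a * hnorm v.
Proof.
apply/(@complexI R); rewrite -hnormE normrZ hnormE rmorphM/=; congr (_ * _).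
Qed.

Lemma hnormD_sqr u v :
  hnorm (u + v) ^+ 2 = hnorm u ^+ 2 + 2 * complex.Re (hdot u v) + hnorm v ^+ 2.
Proof.
rewrite !hnorm_sqr hdotDl !hdotDr !complex_ReD (hdotC u v) complex_Re_conj.
by ring.
Qed.

Lemma hnormB_sqr u v :
  hnorm (u - v) ^+ 2 = hnorm u ^+ 2 - 2 * complex.Re (hdot u v) + hnorm v ^+ 2.
Proof. by rewrite hnormD_sqr hdotNr hnormN complex_ReN mulrN. Qed.

(** For nonzero [u] and [v], the squared norm of |v| u - |u| v equals 2 |u| |v| (|u| |v| - Re
    <u,v>), and it is nonnegative. *)
Lemma cauchy_schwarz u v : complex.Re (hdot u v) <= hnorm u * hnorm v.
Proof.
have [u0|u0] := eqVneq (hnorm u) 0.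
  by rewrite u0 (hnorm_eq0 u0) hdot0l mul0r.
have [v0|v0] := eqVneq (hnorm v) 0.
  by rewrite v0 (hnorm_eq0 v0) hdot0r mulr0.
have up : 0 < hnorm u by rewrite lt_neqAle eq_sym u0 hnorm_ge0.
have vp : 0 < hnorm v by rewrite lt_neqAle eq_sym v0 hnorm_ge0.
have := sqr_ge0 (hnorm (real_complex R (hnorm v) *: u
                        - real_complex R (hnorm u) *: v)).
rewrite hnormB_sqr !hnormZ hdotZl hdotZr conjc_real !complex_Re_rM.
rewrite /= expr0n /= !addr0 !sqrtr_sqr !gtr0_norm//.
rewrite (_ : _ + _ = 2 * (hnorm u * hnorm v) *
  (hnorm u * hnorm v - complex.Re (hdot u v))); last by ring.
by rewrite pmulr_rge0 ?subr_ge0// !mulr_gt0.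
Qed.

Lemma normr_Re_hdot u v : `|complex.Re (hdot u v)| <= hnorm u * hnorm v.
Proof.
rewrite ler_norml cauchy_schwarz andbT lerNl -complex_ReN -hdotNl.
by rewrite -[hnorm u]hnormN cauchy_schwarz.
Qed.

(** The scalars [1] and [-i] give the real and the imaginary part. Limits of scalar products can
    thus be handled as limits of real sequences. *)
Lemma hdot_ReP u v w z :
  (forall a, complex.Re (hdot (a *: u) v) = complex.Re (hdot (a *: w) z)) ->
  hdot u v = hdot w z.
Proof.
move=> h; apply/eqP; rewrite eq_complex !complex_Im_Re -!hdotZl h eqxx andbT.
by rewrite -[u]scale1r -[w]scale1r h.
Qed.

Lemma hdot_inj u v : (forall w, hdot u w = hdot v w) -> u = v.
Proof.
move=> uv; apply/subr0_eq/hnorm_eq0/eqP.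
by rewrite -sqrf_eq0 hnorm_sqr hdotBl uv subrr.
Qed.

Lemma cvg_Re_hdot (x : nat -> H) u w :
  (fun n => hnorm (u - x n)) @ \oo --> (0 : R) ->
  (fun n => complex.Re (hdot (x n) w)) @ \oo --> complex.Re (hdot u w).
Proof.
move=> xu.
apply: (@cvg_dist_le _ _ (fun n => hnorm (u - x n) * hnorm w)) => [n|].
  by rewrite -complex_ReN -complex_ReD -hdotBl hnormB normr_Re_hdot.
by rewrite -(mul0r (hnorm w)); apply: cvgM => //; exact: cvg_cst.
Qed.

Lemma bounded_opP T : bounded_op T ->
  exists2 C : R, 0 <= C & forall v, hnorm (T v) <= C * hnorm v.
Proof.
move=> [Tl Tc].
pose TL : {linear H -> H} := HB.pack T (GRing.isLinear.Build _ _ _ _ T Tl).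
have /linear_boundedP : bounded_near TL (nbhs (0 : H)).
  by have := @continuous_linear_bounded _ _ _ 0 TL (Tc 0).
move=> [c [creal /(_ (c + 1))]]; rewrite ltrDl ltr01 => /(_ isT) h.
(* Norms take values in [R[i]], so the bound is first turned into a real number. *)
have cE : c + 1 = real_complex R (complex.Re (c + 1)).
  by rewrite RRe_real// rpredD// rpred1.
(* If [H] is the zero space, [c + 1] may be negative. *)
exists (Num.max 0 (complex.Re (c + 1))); first by rewrite le_max lexx.
move=> v; have := h v; rewrite cE !hnormE -rmorphM lecR => /le_trans; apply.
by rewrite ler_wpM2r ?hnorm_ge0// le_max lexx orbT.
Qed.

End hilbert_space.

(** * Expansions in an orthonormal basis and the existence of adjoints *)

Section orthonormal_basis.
Variables (R : realType) (H : hilbertType R) (b : nat -> H).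
Hypothesis hb : orthonormal_basis b.
Implicit Types (u v w : H) (T S : H -> H) (c : nat -> R[i]).

Let psum c n := \sum_(0 <= k < n) c k *: b k.

Let hdot_onb i j : i <> j -> hdot (b i) (b j) = 0.
Proof. by case: hb => h _ _; exact: h. Qed.

Let hnorm_onb i : hnorm (b i) = 1 \/ b i = 0.
Proof.
by case: hb => _ /(_ i)[b1|->] _; [left; rewrite /hnorm b1|right].
Qed.

Let hdot_sum_onb m n c j : (n <= j)%N ->
  hdot (\sum_(m <= k < n) c k *: b k) (b j) = 0.
Proof.
move=> nj; rewrite hdot_suml big_nat big1// => i /andP[_ ni].
rewrite hdotZl hdot_onb ?mulr0// => ij.
by move: ni; rewrite ij ltnNge nj.
Qed.

(** Pythagoras, by adding one orthogonal term at a time. It is only an inequality because some [b k]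
    may be zero. *)
Let hnorm_sum_onb c m n : hnorm (\sum_(m <= k < n) c k *: b k) ^+ 2 <=
  \sum_(m <= k < n) Normc.normc (c k) ^+ 2.
Proof.
have [nm|/ltnW mn] := leqP n m; first by rewrite !big_geq// hnorm0 expr0n.
rewrite -(subnKC mn); elim: (n - m)%N => [|k ih].
  by rewrite addn0 !big_geq// hnorm0 expr0n.
rewrite addnS !big_nat_recr ?leq_addr//= hnormD_sqr hdotZr hdot_sum_onb//.
rewrite mulr0 mulr0 addr0 lerD// hnormZ exprMn.
have [->|->] := hnorm_onb (m + k); first by rewrite expr1n mulr1.
by rewrite hnorm0 expr0n mulr0 sqr_ge0.
Qed.

(** The series of the squared moduli is increasing and bounded, hence Cauchy; by Pythagoras the
    vector series is Cauchy too, and [H] is complete. *)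
Lemma riesz_fischer c (M : R) :
  (forall n, \sum_(0 <= k < n) Normc.normc (c k) ^+ 2 <= M) ->
  exists x,
    (fun n => hnorm (x - \sum_(0 <= k < n) c k *: b k)) @ \oo --> (0 : R).
Proof.
move=> cM; set a : nat -> R := fun k => Normc.normc (c k) ^+ 2.
have acvg : cvgn (series a).
  apply: nondecreasing_is_cvgn.
    by apply: nondecreasing_series => k _ _; rewrite sqr_ge0.
  by exists M => _ [n _ <-]; exact: cM.
have : cvgn (series (fun k => c k *: b k)).
  apply/cauchy_cvgP/cauchy_seriesP => e e0.
  (* The Cauchy criterion in [H] quantifies over positive elements of [R[i]], which are real. *)
  have eE : e = real_complex R (complex.Re e) by rewrite RRe_real// gtr0_real.
  have r0 : 0 < complex.Re e by rewrite -ltcR -eE.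
  move/cauchy_cvgP/cauchy_seriesP : acvg => /(_ _ (exprn_gt0 2 r0)).
  apply: filterS => -[m n] /= h; rewrite eE hnormE ltcR.
  rewrite -(ltr_pXn2r (n:=2)) ?nnegrE ?hnorm_ge0 ?(ltW r0)//.
  apply: le_lt_trans (hnorm_sum_onb _ _ _) _.
  by apply: le_lt_trans h; exact: ler_norm.
move=> /cvg_ex[x xP]; exists x.
apply/cvgr0Pnorm_lt => e e0.
have e0' : 0 < real_complex R e by rewrite ltcR.
move/cvgrPdist_lt: xP => /(_ _ e0'); apply: filterS => n.
by rewrite hnormE ltcR ger0_norm// hnorm_ge0.
Qed.

(** Equality holds even where [b k] is zero, since the coefficient [hdot v (b k)] is then zero as
    well. *)
Lemma onb_bessel_eq v n :
  hnorm (v - \sum_(0 <= k < n) hdot v (b k) *: b k) ^+ 2 =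
  hnorm v ^+ 2 - \sum_(0 <= k < n) Normc.normc (hdot v (b k)) ^+ 2.
Proof.
elim: n => [|n ih]; first by rewrite !big_geq// !subr0.
rewrite !big_nat_recr//= !opprD !addrA hnormB_sqr ih.
rewrite hdotZr hdotBl hdot_sum_onb// subr0.
rewrite [conjc _ * _]mulrC mulc_conj hnormZ exprMn /=.
have [->|b0] := hnorm_onb n; first by ring.
by rewrite b0 hdot0r hnorm0 Normc.normc0; ring.
Qed.

(** By Bessel's inequality and Riesz-Fischer the expansion has a sum [x]. The difference [v - x] is
    orthogonal to every [b i], hence zero. *)
Lemma onb_expansion v :
  (fun n => hnorm (v - \sum_(0 <= k < n) hdot v (b k) *: b k)) @ \oo
    --> (0 : R).
Proof.
have [|x xP] := @riesz_fischer (fun k => hdot v (b k)) (hnorm v ^+ 2).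
  by move=> n; rewrite -subr_ge0 -onb_bessel_eq sqr_ge0.
suff vx : v = x by move: xP; rewrite -vx.
apply/subr0_eq; case: hb => _ _ hb0; apply: hb0 => i.
rewrite hdotBl; apply/eqP; rewrite subr_eq0; apply/eqP; apply: hdot_ReP => a.
have h := cvg_Re_hdot (w := conjc a *: b i) xP.
have h' : (fun n => complex.Re (hdot (psum (fun k => hdot v (b k)) n)
    (conjc a *: b i))) @ \oo --> complex.Re (hdot v (conjc a *: b i)).
  (* The term of index [i] enters with the partial sum up to [i.+1]; from there on the scalar
     product with [b i] is constant. *)
  apply: cvg_near_cst; exists i.+1 => // n /= ni.
  apply/subr0_eq; rewrite -complex_ReN -complex_ReD -hdotBl hdotZr.
  rewrite hdotBl /psum hdot_suml (bigD1_seq i) ?iota_uniq//=; last first.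
    by rewrite mem_index_iota.
  rewrite big1 ?addr0; last first.
    by move=> j /eqP ji; rewrite hdotZl hdot_onb ?mulr0.
  rewrite hdotZl hdot_hnorm.
  have [->|->] := hnorm_onb i; first by rewrite expr1n mulr1 subrr mulr0.
  by rewrite !hdot0r mul0r subr0 mulr0.
by rewrite !hdotZl -{1 2}[a]conjcK -!hdotZr; exact: (cvg_unique _ h' h).
Qed.

Lemma parseval v : ((hnorm v ^+ 2)%:E =
  \sum_(0 <= k <oo) (Normc.normc (hdot v (b k)) ^+ 2)%:E)%E.
Proof.
apply/esym/cvg_lim => //.
under eq_fun do rewrite sumEFin.
apply: cvg_EFin; first exact: nearW.
rewrite (_ : fine \o _ = fun n => hnorm v ^+ 2 -
    hnorm (v - \sum_(0 <= k < n) hdot v (b k) *: b k) ^+ 2); last first.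
  by apply/funext => n /=; rewrite onb_bessel_eq subKr.
rewrite -[X in _ --> X]subr0; apply: cvgB; first exact: cvg_cst.
rewrite -[X in _ --> X](mulr0 0); under eq_fun do rewrite expr2.
by apply: cvgM; exact: onb_expansion.
Qed.

(** The Riesz representation of u |-> <T u, v>, built from coordinates in the basis. *)
Lemma adjoint_exists T : bounded_op T ->
  exists S, forall u v, hdot (T u) v = hdot u (S v).
Proof.
move=> bT; have [C C0 TC] := bounded_opP bT; have [Tl _] := bT.
have [TL TE] : exists TL : {linear H -> H}, T = TL.
  pose TL : {linear H -> H} := HB.pack T (GRing.isLinear.Build _ _ _ _ T Tl).
  by exists TL.
suff /choice[S hS] : forall v, exists x, forall u, hdot (T u) v = hdot u x.
  by exists S => u v; exact: hS.
move=> v.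
(* These are the coordinates <x, b_k> that the representing vector must have. *)
pose c k := conjc (hdot (T (b k)) v).
have T_psum a n : T (psum a n) = \sum_(0 <= k < n) a k *: T (b k).
  rewrite TE /psum linear_sum; apply: eq_bigr => k _.
  by rewrite linearZ.
have psumE u a n :
    hdot u (psum a n) = \sum_(0 <= k < n) conjc (a k) * hdot u (b k).
  rewrite hdotC hdot_suml rmorph_sum; apply: eq_bigr => k _ /=.
  by rewrite -hdotC hdotZr.
(* Let p be the partial sum and s the sum of squared moduli. Then s = Re <T p, v> <= C |p| |v| and
   |p|^2 <= s, so s^2 <= (C |v|)^2 s; divide by s. *)
have cM n : \sum_(0 <= k < n) Normc.normc (c k) ^+ 2 <= (C * hnorm v) ^+ 2.
  set s := (X in X <= _).
  have s0 : 0 <= s by apply: sumr_ge0 => k _; exact: sqr_ge0.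
  have : s <= C * hnorm (psum c n) * hnorm v.
    have -> : s = complex.Re (hdot (T (psum c n)) v).
      rewrite T_psum hdot_suml /s.
      rewrite (big_morph (@complex.Re R) (@complex_ReD R) (erefl _)).
      apply: eq_bigr => k _; rewrite hdotZl /c mulrC mulc_conj normc_conj //.
    apply: le_trans (cauchy_schwarz _ _) _.
    by rewrite ler_wpM2r ?hnorm_ge0.
  have := hnorm_sum_onb c 0 n; rewrite -/s -/(psum c n).
  have := hnorm_ge0 (psum c n); have := hnorm_ge0 v.
  set p := hnorm (psum c n); set q := hnorm v => q0 p0 ps sp.
  have [s00|s00] := eqVneq s 0; first by rewrite s00 sqr_ge0.
  have sp0 : 0 < s by rewrite lt_neqAle eq_sym s00.
  rewrite -(ler_pM2l sp0) -expr2.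
  apply: (@le_trans _ _ ((C * p * q) ^+ 2)).
    by rewrite ler_pXn2r// nnegrE// !mulr_ge0.
  rewrite mulrAC [X in X <= _]exprMn mulrC ler_wpM2r// sqr_ge0//.
have [x xP] := riesz_fischer cM; exists x => u.
apply: hdot_ReP => a; rewrite TE -linearZ -TE.
move: (a *: u) => {a}u /=.
have h1 := cvg_Re_hdot (w := u) xP.
have h2 : (fun n => complex.Re (hdot (T (psum (fun k => hdot u (b k)) n)) v))
    @ \oo --> complex.Re (hdot (T u) v).
  apply: cvg_Re_hdot.
  apply: (@cvg_dist_le _ _
    (fun n => C * hnorm (u - psum (fun k => hdot u (b k)) n))) => [n|].
    rewrite subr0 ger0_norm ?hnorm_ge0// TE -linearB -TE; exact: TC.
  by rewrite -(mulr0 C); apply: cvgM; [exact: cvg_cst|exact: onb_expansion].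
(* Truncated at [n], both sides are the real part of the sum of <u, b_k> <T b_k, v> over k < n. *)
suff E : (fun n => complex.Re (hdot (psum c n) u)) =
    (fun n => complex.Re (hdot (T (psum (fun k => hdot u (b k)) n)) v)).
  rewrite E in h1; rewrite (hdotC x) complex_Re_conj.
  exact: cvg_unique _ h2 h1.
apply/funext => n; rewrite (hdotC u) complex_Re_conj psumE T_psum.
rewrite hdot_suml; congr complex.Re; apply: eq_bigr => k _.
by rewrite hdotZl /c conjcK mulrC.
Qed.

End orthonormal_basis.

(** * Hilbert-Schmidt operators and cyclicity of the trace *)

Lemma cvg_series_fine (R : realType) (a : nat -> R) : (forall n, 0 <= a n) ->
  (\sum_(0 <= n <oo) (a n)%:E < +oo)%E ->
  series a @ \oo --> fine (\sum_(0 <= n <oo) (a n)%:E)%E.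
Proof.
move=> a0 afin.
have sfin : (\sum_(0 <= n <oo) (a n)%:E)%E \is a fin_num.
  by rewrite ge0_fin_numE// nneseries_ge0// => n _ _; rewrite lee_fin.
have : (fun n => \sum_(0 <= k < n) (a k)%:E)%E @ \oo -->
    (fine (\sum_(0 <= n <oo) (a n)%:E))%:E%E.
  rewrite fineK//; apply: is_cvg_nneseries => n _ _; by rewrite lee_fin.
move/fine_cvg; rewrite (_ : fine \o _ = series a)//; apply/funext => n /=.
by rewrite sumEFin.
Qed.

Section hilbert_schmidt_operators.
Variables (R : realType) (H : hilbertType R).
Implicit Types (u v w : H) (A B C T S : H -> H) (x y : nat -> H).

Let sqsum x := (\sum_(0 <= n <oo) (hnorm (x n) ^+ 2)%:E)%E.

(** By the parallelogram law, |x + y|^2 <= 2 (|x|^2 + |y|^2). *)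
Let sqsumD_fin x y : (sqsum x < +oo)%E -> (sqsum y < +oo)%E ->
  (sqsum (fun n => x n + y n)%R < +oo)%E.
Proof.
move=> xfin yfin.
apply: (@le_lt_trans _ _ ((2%:E * (sqsum x + sqsum y))%E)); last first.
  by rewrite lte_mul_pinfty// lte_add_pinfty.
rewrite /sqsum -nneseriesD; [|by move=> *; rewrite lee_fin sqr_ge0..].
rewrite -nneseriesZl; last first.
  by move=> n _; rewrite adde_ge0// lee_fin sqr_ge0.
apply: lee_nneseries => n _; first by move=> _; rewrite lee_fin sqr_ge0.
rewrite -EFinD -EFinM lee_fin hnormD_sqr.
have := sqr_ge0 (hnorm (x n - y n)); rewrite hnormB_sqr; lra.
Qed.

Let sqsumZ_fin (a : R[i]) x : (sqsum x < +oo)%E ->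
  (sqsum (fun n => a *: x n)%R < +oo)%E.
Proof.
move=> xfin.
apply: (@le_lt_trans _ _ (((Normc.normc a ^+ 2)%:E * sqsum x)%E)); last first.
  by rewrite lte_mul_pinfty// lee_fin sqr_ge0.
rewrite /sqsum -nneseriesZl; last by move=> n _; rewrite lee_fin sqr_ge0.
apply: lee_nneseries => n _; first by move=> _; rewrite lee_fin sqr_ge0.
by rewrite -EFinM lee_fin hnormZ exprMn.
Qed.

Let sqsumN x : sqsum (fun n => - x n) = sqsum x.
Proof. by apply: eq_eseriesr => n _; rewrite hnormN. Qed.

Let sqsumB_fin x y : (sqsum x < +oo)%E -> (sqsum y < +oo)%E ->
  (sqsum (fun n => x n - y n)%R < +oo)%E.
Proof. by move=> xfin yfin; apply: sqsumD_fin; rewrite ?sqsumN. Qed.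

(* Polarization expresses the real part of a trace by Hilbert-Schmidt norms,
   so that cyclicity reduces to their invariance under adjunction. *)
Lemma cvg_series_Re_hdot x y : (sqsum x < +oo)%E -> (sqsum y < +oo)%E ->
  series (fun n => complex.Re (hdot (x n) (y n))) @ \oo -->
  (fine (sqsum (fun n => x n + y n)) - fine (sqsum (fun n => x n - y n))) / 4.
Proof.
move=> xfin yfin.
have hD := cvg_series_fine (fun n => sqr_ge0 _) (sqsumD_fin xfin yfin).
have hB := cvg_series_fine (fun n => sqr_ge0 _) (sqsumB_fin xfin yfin).
rewrite (_ : series _ = fun n =>
    (series (fun n => hnorm (x n + y n) ^+ 2) n -
     series (fun n => hnorm (x n - y n) ^+ 2) n) * 4^-1).
  by apply: cvgM (cvg_cst _); exact: cvgB.
apply/funext => n; rewrite /series /= -sumrB mulr_suml; apply: eq_bigr => k _.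
by rewrite hnormD_sqr hnormB_sqr; field.
Qed.

Lemma onb_or_zero : orthonormal_basis (onb H) \/ forall n, onb H n = 0.
Proof.
have [[b hb]|nb] := pselect (exists b : nat -> H, orthonormal_basis b).
  by left; rewrite /onb; apply: xgetPex; exists b.
right=> n; rewrite /onb xgetPN// => b hb; apply: nb; by exists b.
Qed.

Lemma trace_eq0 T : (forall n, hdot (T (onb H n)) (onb H n) = 0) -> trace T = 0.
Proof.
move=> T0; rewrite /trace.
have s0 : series (fun=> 0 : R) = fun=> 0 :> R.
  by apply/funext => n; rewrite /series /= big1.
under eq_fun do rewrite T0.
under [X in Complex _ (limn (series X))]eq_fun do rewrite T0.
by rewrite /= s0 lim_cst.
Qed.

Lemma hsnorm2_ge0 T : (0 <= hsnorm2 T)%E.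
Proof. by apply: nneseries_ge0 => n _ _; rewrite lee_fin sqr_ge0. Qed.

Lemma hsnorm2_comp_le T F (c : R) : (forall v, hnorm (F v) <= c * hnorm v) ->
  (hsnorm2 (F \o T) <= (c ^+ 2)%:E * hsnorm2 T)%E.
Proof.
move=> Fc; rewrite /hsnorm2 -nneseriesZl; last first.
  by move=> n _; rewrite lee_fin sqr_ge0.
apply: lee_nneseries => n _; first by move=> _; rewrite lee_fin sqr_ge0.
rewrite -EFinM lee_fin -exprMn ler_pXn2r// ?nnegrE ?hnorm_ge0//=.
exact: le_trans (hnorm_ge0 _) (Fc _).
Qed.

Section with_basis.
Hypothesis hb : orthonormal_basis (onb H).

Lemma adjP T : bounded_op T -> forall u v, hdot (T u) v = hdot u (adj T v).
Proof. by move=> bT; exact: (xgetPex (fun=> 0) (adjoint_exists hb bT)). Qed.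

(** With T' the adjoint, |T' v|^2 = Re <T T' v, v> <= c |T' v| |v|; cancel one factor. *)
Lemma hnorm_adj_le T (c : R) : bounded_op T ->
  (forall v, hnorm (T v) <= c * hnorm v) ->
  forall v, hnorm (adj T v) <= c * hnorm v.
Proof.
move=> bT Tc v; have [->|a0] := eqVneq (hnorm (adj T v)) 0.
  exact: le_trans (hnorm_ge0 _) (Tc v).
have ap : 0 < hnorm (adj T v) by rewrite lt_neqAle eq_sym a0 hnorm_ge0.
rewrite -(ler_pM2l ap) -expr2 hnorm_sqr -(adjP bT).
apply: le_trans (cauchy_schwarz _ _) _.
by rewrite mulrCA mulrA ler_wpM2r ?hnorm_ge0.
Qed.

(** By Parseval both sides are the double series of |<T b_i, b_k>|^2, summed in the two orders. [S]
    is any adjoint, so that sums and differences of operators can be inserted directly. *)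
Lemma hsnorm2_adjoint T S : (forall u v, hdot (T u) v = hdot u (S v)) ->
  hsnorm2 T = hsnorm2 S.
Proof.
move=> TS; rewrite /hsnorm2.
under eq_eseriesr do rewrite (parseval hb).
rewrite nneseries_interchange; last first.
  by move=> i j; rewrite lee_fin sqr_ge0.
apply: eq_eseriesr => n _; rewrite (parseval hb); apply: eq_eseriesr => k _.
by rewrite TS hdotC normc_conj.
Qed.

(** Polarization expresses the first limit by the Hilbert-Schmidt norms of C + A' and C - A', the
    second by those of A + C' and A - C'. The sums are adjoint to each other, and so are the
    differences up to sign. *)
Let cvg_Re_trace A A' C C' :
  (forall u v, hdot (A u) v = hdot u (A' v)) ->
  (forall u v, hdot (C u) v = hdot u (C' v)) ->
  (hsnorm2 A < +oo)%E -> (hsnorm2 C < +oo)%E ->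
  exists l : R,
    series (fun n => complex.Re (hdot (A (C (onb H n))) (onb H n))) @ \oo
      --> l /\
    series (fun n => complex.Re (hdot (C (A (onb H n))) (onb H n))) @ \oo --> l.
Proof.
move=> hA hC Afin Cfin.
have A'fin : (hsnorm2 A' < +oo)%E by rewrite -(hsnorm2_adjoint hA).
have C'fin : (hsnorm2 C' < +oo)%E by rewrite -(hsnorm2_adjoint hC).
have hAC n :
    hdot (A (C (onb H n))) (onb H n) = hdot (C (onb H n)) (A' (onb H n)).
  exact: hA.
have hCA n :
    hdot (C (A (onb H n))) (onb H n) = hdot (A (onb H n)) (C' (onb H n)).
  exact: hC.
eexists; split.
  by under eq_fun do rewrite hAC; exact: cvg_series_Re_hdot Cfin A'fin.
under eq_fun do rewrite hCA.
suff -> : sqsum (fun n => C (onb H n) + A' (onb H n)) =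
    sqsum (fun n => A (onb H n) + C' (onb H n)).
  suff -> : sqsum (fun n => C (onb H n) - A' (onb H n)) =
      sqsum (fun n => A (onb H n) - C' (onb H n)) by exact: cvg_series_Re_hdot.
  (* The adjoint of A' - C, not of C - A', is A - C'; the sign does not change the norm. *)
  rewrite -sqsumN; under [LHS]eq_eseriesr do rewrite opprB.
  apply: (@hsnorm2_adjoint (fun u => A' u - C u) (fun u => A u - C' u)) => u v.
  by rewrite hdotBl hdotDr hdotNr hC (hdotC (A v)) hA -hdotC.
apply: (@hsnorm2_adjoint (fun u => C u + A' u) (fun u => A u + C' u)) => u v.
by rewrite hdotDl hdotDr hC (hdotC (A v)) hA -hdotC addrC.
Qed.

Lemma trace_comp_comm A A' C C' :
  (forall u v, hdot (A u) v = hdot u (A' v)) ->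
  (forall u v, hdot (C u) v = hdot u (C' v)) ->
  (hsnorm2 A < +oo)%E -> (hsnorm2 C < +oo)%E ->
  trace (A \o C) = trace (C \o A).
Proof.
move=> hA hC Afin Cfin; rewrite /trace /=; congr Complex.
  have [l [h1 h2]] := cvg_Re_trace hA hC Afin Cfin.
  by rewrite (cvg_lim _ h1)// (cvg_lim _ h2).
(* For the imaginary parts, the result on real parts is applied to [-i C]. *)
pose Ci u := - 'i%C *: C u; pose Ci' u := conjc (- 'i%C) *: C' u.
have hCi u v : hdot (Ci u) v = hdot u (Ci' v).
  by rewrite /Ci /Ci' hdotZl hdotZr conjcK hC.
have Cifin : (hsnorm2 Ci < +oo)%E by exact: sqsumZ_fin Cfin.
have [l [h1 h2]] := cvg_Re_trace hA hCi Afin Cifin.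
transitivity l; last apply/esym.
  rewrite -(cvg_lim _ h1)//; congr (limn (series _)); apply/funext => n.
  by rewrite complex_Im_Re !hA hdotZl.
rewrite -(cvg_lim _ h2)//; congr (limn (series _)); apply/funext => n.
by rewrite complex_Im_Re hdotZl.
Qed.

(** Passing to adjoints turns right multiplication by [F] into left multiplication by its adjoint,
    where the bound can be applied to each basis vector. *)
Lemma hsnorm2_compr_basis A F (c : R) :
  bounded_op A -> bounded_op F -> 0 <= c ->
  (forall v, hnorm (F v) <= c * hnorm v) ->
  (hsnorm2 (A \o F) <= (c ^+ 2)%:E * hsnorm2 A)%E.
Proof.
move=> bA bF c0 Fc.
rewrite (@hsnorm2_adjoint _ (adj F \o adj A)); last first.
  by move=> u v /=; rewrite !adjP.
rewrite (hsnorm2_adjoint (adjP bA)); apply: hsnorm2_comp_le.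
exact: hnorm_adj_le.
Qed.

End with_basis.

(** If there is no basis, [onb] is zero and the left side vanishes, because [A] and [F] fix 0. *)
Lemma hsnorm2_compr_le A F (c : R) : bounded_op A -> bounded_op F -> 0 <= c ->
  (forall v, hnorm (F v) <= c * hnorm v) ->
  (hsnorm2 (A \o F) <= (c ^+ 2)%:E * hsnorm2 A)%E.
Proof.
case: onb_or_zero => [hb|b0] bA bF c0 Fc; first exact: hsnorm2_compr_basis.
apply: (@le_trans _ _ 0%E); last first.
  by rewrite mule_ge0 ?hsnorm2_ge0// lee_fin sqr_ge0.
rewrite /hsnorm2 eseries0// => n _ _ /=.
have F0 : F 0 = 0.
  by apply: hnorm_eq0; apply/eqP; rewrite eq_le hnorm_ge0 andbT;
    rewrite (le_trans (Fc 0))// hnorm0 mulr0.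
have [C' _ AC] := bounded_opP bA.
have -> : A (F (onb H n)) = 0.
  rewrite b0 F0; apply: hnorm_eq0; apply/eqP; rewrite eq_le hnorm_ge0 andbT.
  by rewrite (le_trans (AC 0))// hnorm0 mulr0.
by rewrite hnorm0 expr0n.
Qed.

Lemma hilbert_schmidt_comp A F : hilbert_schmidt A -> bounded_op F ->
  hilbert_schmidt (A \o F).
Proof.
move=> [[Al Ac] Afin] bF; have [Fl Fc] := bF; split; first split.
- by move=> a u v /=; rewrite Fl Al.
- by move=> u; apply: continuous_comp; [exact: Fc|exact: Ac].
have [c c0 cF] := bounded_opP bF.
apply: le_lt_trans (hsnorm2_compr_le _ bF c0 cF) _; first by split.
by rewrite lte_mul_pinfty// lee_fin sqr_ge0.
Qed.

(** Cyclicity for the pair [A] and [F \o adj B]. The latter has finite Hilbert-Schmidt norm, and its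
    adjoint is [B \o adj F]. *)
Lemma trace_mulC A B F : hilbert_schmidt A -> hilbert_schmidt B ->
  bounded_op F -> trace (A \o F \o adj B) = trace (F \o adj B \o A).
Proof.
case: onb_or_zero => [hb|b0]; last first.
  by move=> _ _ _; rewrite !trace_eq0// => n; rewrite b0 hdot0r.
move=> [bA Afin] [bB Bfin] bF.
rewrite -compA; apply: (@trace_comp_comm hb _ (adj A) _ (B \o adj F)) => //.
- exact: adjP.
- by move=> u v /=; rewrite adjP// hdotC -adjP// -hdotC.
- have [c c0 cF] := bounded_opP bF.
  apply: le_lt_trans (hsnorm2_comp_le _ cF) _.
  rewrite -(hsnorm2_adjoint hb (adjP hb bB)).
  by rewrite lte_mul_pinfty// lee_fin sqr_ge0.
Qed.

Lemma trace_adj_conj A B : hilbert_schmidt A -> hilbert_schmidt B ->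
  trace (B \o adj A) = conjc (trace (A \o adj B)).
Proof.
case: onb_or_zero => [hb|b0]; last first.
  by move=> _ _; rewrite !trace_eq0 ?conjc0// => n; rewrite b0 hdot0r.
move=> [bA Afin] [bB Bfin].
have E n : hdot (B (adj A (onb H n))) (onb H n) =
    conjc (hdot (A (adj B (onb H n))) (onb H n)).
  by rewrite (adjP hb bB) (adjP hb bA) -hdotC.
rewrite /trace /=; congr Complex.
  by congr (limn (series _)); apply/funext => n; rewrite E complex_Re_conj.
have A'fin : (hsnorm2 (adj A) < +oo)%E.
  by rewrite -(hsnorm2_adjoint hb (adjP hb bA)).
have B'fin : (hsnorm2 (adj B) < +oo)%E.
  by rewrite -(hsnorm2_adjoint hb (adjP hb bB)).
(* A sign can be taken out of [limn] once the series converges; polarization, applied with the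
   factor [-i], gives this for the imaginary parts. *)
have := cvg_series_Re_hdot (sqsumZ_fin (- 'i%C) B'fin) A'fin.
rewrite (_ : (fun n => _) =
  (fun n => complex.Im (hdot (A (adj B (onb H n))) (onb H n)))); last first.
  by apply/funext => n; rewrite hdotZl -complex_Im_Re (adjP hb bA).
set f := (fun n => complex.Im _) => fl.
rewrite (cvg_lim _ fl)//; apply: cvg_lim => //.
rewrite (_ : series _ = fun n => - series f n); first exact: cvgN.
apply/funext => n; rewrite /series /= -sumrN; apply: eq_bigr => k _.
by rewrite E /f; case: hdot.
Qed.

End hilbert_schmidt_operators.

(** * Integrals of functions not known to be measurable *)

Section integrals_without_measurability.
Context d (T : measurableType d) (R : realType).
Variable mu : {measure set T -> \bar R}.
Implicit Types f g : T -> \bar R.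

Import HBNNSimple.

(* No measurability is assumed: the integral of a nonnegative function is a
   supremum over the simple functions below it, and these can be cut off on a
   null set. *)
Lemma ge0_ae_le_integralZ f g (c : R) : 0 < c ->
  (forall t, 0 <= f t)%E -> (forall t, 0 <= g t)%E ->
  (\forall t \ae mu, f t <= c%:E * g t)%E ->
  (\int[mu]_t f t <= c%:E * \int[mu]_t g t)%E.
Proof.
move=> c0 f0 g0 [N [mN N0 fgN]].
rewrite ge0_integralTE//; apply: ge_ereal_sup => _ [h hf <-].
have ci0 : 0 <= c^-1 by rewrite invr_ge0 ltW.
have mNc : measurable (~` N) by exact: measurableC.
pose k := proj_nnsfun h mNc.
have kE t : k t = if t \in ~` N then h t else 0.
  by rewrite /k -mrestrict /patch.
have kg t : ((scale_nnsfun k ci0 t)%:E <= g t)%E.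
  rewrite (_ : scale_nnsfun k ci0 t = c^-1 * k t)// kE.
  have [tN|tN] := boolP (t \in ~` N); last by rewrite mulr0 g0.
  rewrite -(@lee_pmul2l _ c%:E)// ?lte_fin// -EFinM mulrA.
  rewrite divff ?gt_eqF// mul1r; apply: le_trans (hf t) _.
  by apply: contrapT => h1; move: tN; rewrite inE => tN; apply/tN/fgN.
have -> : sintegral mu h = sintegral mu k.
  have := integral_nnsfun mu measurableT h; rewrite patch_setT => <-.
  have := integral_nnsfun mu measurableT k; rewrite patch_setT => <-.
  apply: ae_eq_integral => //.
  - exact/measurable_EFinP/measurable_funP.
  - exact/measurable_EFinP/measurable_funP.
  exists N; split => // t ht; apply: contrapT => tN; apply: ht => _.
  by rewrite kE mem_set.
rewrite -[sintegral mu k]mul1e -(divff (lt0r_neq0 c0)) EFinM -muleA.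
rewrite -sintegralrM lee_pmul2l ?lte_fin//.
rewrite ge0_integralTE//; apply: ereal_sup_ubound.
by exists (scale_nnsfun k ci0).
Qed.

Lemma ge0_ae_eq_integral f g :
  (forall t, 0 <= f t)%E -> (forall t, 0 <= g t)%E ->
  (\forall t \ae mu, f t = g t) -> (\int[mu]_t f t = \int[mu]_t g t)%E.
Proof.
move=> f0 g0 fg; apply/eqP; rewrite eq_le; apply/andP; split.
  rewrite -[leRHS]mul1e; apply: ge0_ae_le_integralZ => //.
  by apply: filterS fg => t ->; rewrite mul1e.
rewrite -[leRHS]mul1e; apply: ge0_ae_le_integralZ => //.
by apply: filterS fg => t ->; rewrite mul1e.
Qed.

Lemma ae_eq_integral_nonmeas f g :
  (\forall t \ae mu, f t = g t) -> (\int[mu]_t f t = \int[mu]_t g t)%E.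
Proof.
move=> fg; rewrite integralE [RHS]integralE; congr (_ - _)%E.
  apply: ge0_ae_eq_integral => [t|t|]; rewrite ?funepos_ge0//.
  by apply: filterS fg => t fgt; rewrite !funeposE fgt.
apply: ge0_ae_eq_integral => [t|t|]; rewrite ?funeneg_ge0//.
by apply: filterS fg => t fgt; rewrite !funenegE fgt.
Qed.

(** Allows representatives of classes to be exchanged inside an integral, in particular in integrals
    of traces, whose measurability is not established here. *)
Lemma ae_eq_cintegral (f g : T -> R[i]) :
  (\forall t \ae mu, f t = g t) -> cintegral mu f = cintegral mu g.
Proof.
move=> fg; rewrite /cintegral /Rintegral; congr (Complex (fine _) (fine _));
  by apply: ae_eq_integral_nonmeas; apply: filterS fg => t ->.
Qed.

(* If both the positive and the negative part have infinite integral, then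
   [fine] gives [0] on both sides. *)
Lemma RintegralN_nonmeas (f : T -> R) :
  \int[mu]_t (- f t) = - \int[mu]_t f t.
Proof.
rewrite /Rintegral.
rewrite (_ : (fun t => (- f t)%:E) = \- (fun t => (f t)%:E))%E; last first.
  by apply/funext.
rewrite integralE [in RHS]integralE funeposN funenegN.
set a := integral _ _ _; set b := integral _ _ _.
by case: a => [a||]; case: b => [b||] //=; rewrite ?oppr0// opprB.
Qed.

Lemma cintegral_conj (f : T -> R[i]) :
  cintegral mu (fun t => conjc (f t)) = conjc (cintegral mu f).
Proof.
rewrite /cintegral /=; congr Complex.
  by apply: eq_Rintegral => t _; rewrite complex_Re_conj.
rewrite -RintegralN_nonmeas; apply: eq_Rintegral => t _.
by case: (f t).
Qed.

Lemma cintegral0 : cintegral mu (fun=> 0) = 0.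
Proof.
rewrite /cintegral /Rintegral.
by rewrite (@integral0_eq _ _ _ mu setT (fun=> (complex.Re 0)%:E)).
Qed.

End integrals_without_measurability.

(** * Nondegeneracy of the scalar product of [L2] *)

Section square_integrable_functions.
Context d (T : measurableType d) (R : realType).
Variable mu : {measure set T -> \bar R}.
Implicit Types (f g : sqfun mu) (a b : L2 mu).

Lemma normc_sqrE (x : R[i]) :
  Normc.normc x ^+ 2 = complex.Re x ^+ 2 + complex.Im x ^+ 2.
Proof. by rewrite normc_sqr; case: x => u v /=; ring. Qed.

Lemma sqfun_integrable f :
  mu.-integrable setT (EFin \o fun t => Normc.normc (f t) ^+ 2).
Proof.
have [mRe mIm] := sqfun_meas f.
apply/integrableP; split.
  apply/measurable_EFinP; under eq_fun do rewrite normc_sqrE.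
  by apply: measurable_funD; exact: measurable_funX.
apply: le_lt_trans (sqfun_fin f); rewrite le_eqVlt; apply/orP; left; apply/eqP.
by apply: eq_integral => t _ /=; rewrite ger0_norm// sqr_ge0.
Qed.

(** Dominated by |f|^2 + |g|^2. *)
Lemma sqfun_dot_integrable f g :
  mu.-integrable setT (EFin \o fun t => complex.Re (f t * conjc (g t))).
Proof.
have [mRf mIf] := sqfun_meas f; have [mRg mIg] := sqfun_meas g.
have E t : complex.Re (f t * conjc (g t)) =
    complex.Re (f t) * complex.Re (g t) + complex.Im (f t) * complex.Im (g t).
  by case: (f t) => u v; case: (g t) => x y /=; ring.
pose nf := EFin \o fun t => Normc.normc (f t) ^+ 2.
pose ng := EFin \o fun t => Normc.normc (g t) ^+ 2.
have : mu.-integrable setT (nf \+ ng)%E.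
  by apply: integrableD => //; exact: sqfun_integrable.
apply: le_integrable => //.
- apply/measurable_EFinP; under eq_fun do rewrite E.
  by apply: measurable_funD; exact: measurable_funM.
- move=> t _ /=; rewrite lee_fin [leRHS]ger0_norm ?addr_ge0 ?sqr_ge0//.
  rewrite E !normc_sqrE ler_norml; apply/andP; split.
    have := sqr_ge0 (complex.Re (f t) + complex.Re (g t)).
    have := sqr_ge0 (complex.Im (f t) + complex.Im (g t)).
    have := sqr_ge0 (complex.Re (f t)); have := sqr_ge0 (complex.Re (g t)).
    have := sqr_ge0 (complex.Im (f t)); have := sqr_ge0 (complex.Im (g t)).
    by nra.
  have := sqr_ge0 (complex.Re (f t) - complex.Re (g t)).
  have := sqr_ge0 (complex.Im (f t) - complex.Im (g t)).
  have := sqr_ge0 (complex.Re (f t)); have := sqr_ge0 (complex.Re (g t)).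
  have := sqr_ge0 (complex.Im (f t)); have := sqr_ge0 (complex.Im (g t)).
  by nra.
Qed.

(** Supplies the test function for nondegeneracy. It is square integrable because |f - g|^2 = |f|^2
    + |g|^2 - 2 Re (f conj(g)). *)
Lemma sqfunB_exists f g : exists h : sqfun mu, forall t, h t = f t - g t.
Proof.
have [mRf mIf] := sqfun_meas f; have [mRg mIg] := sqfun_meas g.
have mB : cmeasurable (fun t => f t - g t).
  split.
    under eq_fun do rewrite complex_ReD complex_ReN.
    exact: measurable_funB.
  rewrite (_ : (fun t => _) = fun t => complex.Im (f t) - complex.Im (g t)).
    exact: measurable_funB.
  by apply/funext => t; case: (f t); case: (g t).
have BE t : Normc.normc (f t - g t) ^+ 2 =
    Normc.normc (f t) ^+ 2 + Normc.normc (g t) ^+ 2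
    - 2 * complex.Re (f t * conjc (g t)).
  rewrite !normc_sqrE; case: (f t) => u v; case: (g t) => x y /=; ring.
have fB : (\int[mu]_t (Normc.normc (f t - g t) ^+ 2)%:E < +oo)%E.
  have : mu.-integrable setT (EFin \o fun t => Normc.normc (f t - g t) ^+ 2).
    pose nf := EFin \o fun t => Normc.normc (f t) ^+ 2.
    pose ng := EFin \o fun t => Normc.normc (g t) ^+ 2.
    pose fg := EFin \o fun t => complex.Re (f t * conjc (g t)).
    rewrite (_ : EFin \o _ = (nf \+ ng) \- (fun t => 2%:E * fg t))%E.
      apply: integrableB => //.
        by apply: integrableD => //; exact: sqfun_integrable.
      by apply: integrableZl => //; exact: sqfun_dot_integrable.
    by apply/funext => t; rewrite /= BE.
  move=> /integrableP[_]; apply: le_lt_trans.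
  rewrite le_eqVlt; apply/orP; left; apply/eqP.
  by apply: eq_integral => t _ /=; rewrite ger0_norm// sqr_ge0.
by exists (SqFun mB fB).
Qed.

Lemma L2_repr_pi f : \forall t \ae mu, L2_fun (\pi_(L2 mu) f)%qT t = f t.
Proof.
apply/asboolP; change (sqfun_eq (repr (\pi_(L2 mu) f)%qT) f).
by apply/eqmodP; rewrite reprK.
Qed.

(** Testing with the class of h = a - b, the real part of the hypothesis says that the integral of
    |h|^2 is zero. *)
Lemma L2_dot_inj a b : (forall v, L2_dot a v = L2_dot b v) -> a = b.
Proof.
move=> ab; have [h hE] := sqfunB_exists (repr a) (repr b).
suff h0 : \forall t \ae mu, h t = 0.
  rewrite -[a]reprK -[b]reprK; apply/eqmodP/asboolP.
  by apply: filterS h0 => t; rewrite hE => /subr0_eq.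
have L2E c : L2_dot c (\pi_(L2 mu) h)%qT =
    cintegral mu (fun t => (repr c : sqfun mu) t * conjc (h t)).
  by apply: ae_eq_cintegral; apply: filterS (L2_repr_pi h) => t ->.
have := ab (\pi_(L2 mu) h)%qT; rewrite !L2E => -[/eqP + _].
rewrite -subr_eq0 -RintegralB//; [|exact: sqfun_dot_integrable..].
rewrite (_ : (fun t => _) = fun t => Normc.normc (h t) ^+ 2); last first.
  by apply/funext => t; rewrite normc_sqr hE -complex_ReN -complex_ReD -mulrBl.
rewrite /Rintegral => /eqP h2.
have hint := sqfun_integrable h.
have : (\int[mu]_t `|(Normc.normc (h t) ^+ 2)%:E| = 0)%E.
  under eq_integral do rewrite abse_EFin ger0_norm ?sqr_ge0//.
  (* [fine] would also send an infinite integral to 0; integrability excludes this. *)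
  by rewrite -[LHS]fineK ?h2// (integrable_fin_num measurableT hint).
have /integrableP[hm _] := hint.
move=> /(ae_eq_integral_abs mu measurableT hm).
apply: filterS => t /(_ I) [] ht; apply/Normc.eq0_normc/eqP.
by rewrite -sqrf_eq0 ht.
Qed.

End square_integrable_functions.

(** * Square-integrable fields of Hilbert-Schmidt operators *)

Section hilbert_schmidt_fields.
Context d (T : measurableType d) (R : realType).
Variables (sp : T -> hilbertType R) (e : nat -> forall t, sp t).
Variable mu : {measure set T -> \bar R}.
Implicit Types A B : HS2 e mu.

Lemma opnorm_le (H : hilbertType R) (S : H -> H) (c : R) : linear S ->
  (opnorm S <= c%:E)%E -> forall v, hnorm (S v) <= c * hnorm v.
Proof.
move=> Sl Sc v; pose SL : {linear H -> H} :=
  HB.pack S (GRing.isLinear.Build _ _ _ _ S Sl).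
have SE : S = SL by [].
have [v0|v0] := eqVneq (hnorm v) 0.
  by rewrite (hnorm_eq0 v0) SE linear0 hnorm0 mulr0.
have vp : 0 < hnorm v by rewrite lt_neqAle eq_sym v0 hnorm_ge0.
have nv : Normc.normc (real_complex R (hnorm v)^-1) = (hnorm v)^-1.
  by rewrite /= expr0n addr0 sqrtr_sqr ger0_norm// invr_ge0 ltW.
have : ((hnorm (S (real_complex R (hnorm v)^-1 *: v)))%:E <= c%:E)%E.
  apply: le_trans Sc; apply: ereal_sup_ubound.
  exists (real_complex R (hnorm v)^-1 *: v) => //=.
  by rewrite hnormZ nv mulVf.
by rewrite lee_fin SE linearZ -SE hnormZ nv mulrC ler_pdivrMr.
Qed.

Lemma HS2_repr_pi (A : hsfield e mu) :
  \forall t \ae mu, HS2_fun (\pi_(HS2 e mu) A)%qT (t := t) = A t.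
Proof.
apply/asboolP; change (hsfield_eq (repr (\pi_(HS2 e mu) A)%qT) A).
by apply/eqmodP; rewrite reprK.
Qed.

Lemma HS2_zero_ae :
  \forall t \ae mu, HS2_fun (HS2_zero e mu) (t := t) = fun=> 0.
Proof. exact: HS2_repr_pi. Qed.

Lemma HS2_hs A t : hilbert_schmidt (HS2_fun A (t := t)).
Proof. exact: hsfield_hs (repr A : hsfield e mu) t. Qed.

(* [F] is only essentially bounded, so the product is modified on a null set. *)
Lemma HS2_comp_exists A (F : forall t, sp t -> sp t) :
  ess_bounded_field e mu F ->
  exists B, \forall t \ae mu, HS2_fun B (t := t) = HS2_fun A (t := t) \o F t.
Proof.
move=> [bF mF Ffin].
have [c c0 Fc] : exists2 c : R, 0 < c &
    (ess_sup mu (fun t => opnorm (F t)) <= c%:E)%E.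
  move: Ffin; case: ess_sup => [r||]// _.
    (* The maximum with 1 makes the bound strictly positive, as the comparison of integrals
       requires. *)
    exists (Num.max 1 r); first by rewrite lt_max ltr01.
    by rewrite lee_fin le_max lexx orbT.
  (* The essential supremum is [-oo] when the measure is zero. *)
  by exists 1; rewrite ?leNye.
have [N [mN N0 NF]] := ess_supP Fc.
pose B t : sp t -> sp t :=
  if t \in ~` N then HS2_fun A (t := t) \o F t else fun=> 0.
have B_hs t : hilbert_schmidt (B t).
  rewrite /B; case: ifP => _; last exact: hsfield0_hs.
  exact: hilbert_schmidt_comp (HS2_hs A t) (bF t).
have B_meas : measurable_opfield e B.
  move=> f mf n.
  have [m1 m2] := @hsfield_meas _ _ _ _ _ _ (repr A) _ (mF f mf) n.
  have mNc := measurableC mN.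
  have E t : hdot (B t (f t)) (e n t) =
      if t \in ~` N then hdot (HS2_fun A (F t (f t))) (e n t) else 0.
    by rewrite /B; case: ifP => // _; rewrite hdot0l.
  split; under eq_fun do rewrite E.
    rewrite (_ : (fun t => _) = (fun t => complex.Re
      (hdot (HS2_fun A (F t (f t))) (e n t))) \_ (~` N)).
      by apply/(measurable_restrictT _ mNc); exact: measurable_funS m1.
    by apply/funext => t; rewrite /patch; case: ifP.
  rewrite (_ : (fun t => _) = (fun t => complex.Im
    (hdot (HS2_fun A (F t (f t))) (e n t))) \_ (~` N)).
    by apply/(measurable_restrictT _ mNc); exact: measurable_funS m2.
  by apply/funext => t; rewrite /patch; case: ifP.
have B_fin : (\int[mu]_t hsnorm2 (B t) < +oo)%E.
  have c20 : 0 < c ^+ 2 by rewrite exprn_gt0.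
  apply: (@le_lt_trans _ _
    ((c ^+ 2)%:E * \int[mu]_t hsnorm2 (HS2_fun A (t := t)))%E).
    apply: ge0_ae_le_integralZ => // [t|t|]; rewrite ?hsnorm2_ge0//.
    apply: nearW => t; rewrite /B; case: ifPn => tN; last first.
      by rewrite hsnorm2_0 mule_ge0 ?hsnorm2_ge0// lee_fin ltW.
    apply: hsnorm2_compr_le => //; first by case: (HS2_hs A t).
      exact: ltW.
    apply: opnorm_le; first by case: (bF t).
    by apply: contrapT => h; move: tN; rewrite inE; apply; exact: NF.
  by rewrite lte_mul_pinfty ?lee_fin ?(ltW c20)//; exact: hsfield_fin (repr A).
exists (\pi_(HS2 e mu) (HSField B_hs B_meas B_fin))%qT.
have Nae : \forall t \ae mu, (~` N) t by exists N; split => // t /contrapT.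
apply: filterS2 (HS2_repr_pi (HSField B_hs B_meas B_fin)) Nae => t -> tN.
by rewrite /= /B mem_set.
Qed.

Lemma HS2_dotC A B : HS2_dot B A = conjc (HS2_dot A B).
Proof.
rewrite /HS2_dot -cintegral_conj; apply: ae_eq_cintegral; apply: aeW => t.
exact: trace_adj_conj (HS2_hs A t) (HS2_hs B t).
Qed.

End hilbert_schmidt_fields.

(** * The Bargmann transformation and Berezin operators *)

Section berezin_toeplitz.
Variables (R : realType) (G : topologicalGroupType).
Variable m : {sigma_finite_measure set (borel G) -> \bar R}.
Context d (D : measurableType d) (sp : D -> hilbertType R).
Variables (rep : forall xi, @unirep R G (sp xi)) (e : nat -> forall xi, sp xi).
Variable mhat : {sigma_finite_measure set D -> \bar R}.
Variables (w : L2 m) (F : forall X : D * borel G, sp X.1 -> sp X.1).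
Arguments F X : clear implicits.

Local Notation W := (bargmann rep e mhat w).
Local Notation B22 := (B22 m e mhat).
Local Notation berezin_form u v :=
  (cintegral (phase_measure m mhat) (fun X =>
    trace (F X \o adj (HS2_fun (W v) (t := X)) \o HS2_fun (W u) (t := X)))).

Lemma L2_zero_ae : \forall x \ae m, L2_fun (L2_zero m) x = 0.
Proof. exact: L2_repr_pi. Qed.

Lemma L2_dot0l (v : L2 m) : L2_dot (L2_zero m) v = 0.
Proof.
rewrite -(cintegral0 m); apply: ae_eq_cintegral.
by apply: filterS L2_zero_ae => x ->; rewrite mul0r.
Qed.

(** The weak integrals of the zero class vanish, so the zero field is a solution of the identity
    defining [fourier_wigner]. Hence [xget] returns a solution, and any solution is zero almost
    everywhere. *)
Lemma bargmann0 :
  \forall X \ae phase_measure m mhat,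
    HS2_fun (W (L2_zero m)) (t := X) = fun=> 0.
Proof.
have int0 (X : D * borel G) (a b : sp X.1) : cintegral m (fun z =>
    L2_fun (L2_zero m) z * conjc (w ((z : G) * (X.2 : G)^-1)%g) *
      hdot (adj (rep X.1 z) a) b) = 0.
  rewrite -(cintegral0 m); apply: ae_eq_cintegral.
  by apply: filterS L2_zero_ae => x ->; rewrite !mul0r.
have : \forall X \ae phase_measure m mhat,
    is_fourier_wigner m rep (L2_zero m) w (HS2_fun (W (L2_zero m)) (t := X)).
  apply: (@xgetI _ _ [set V : B22 | \forall X \ae phase_measure m mhat,
    is_fourier_wigner m rep (L2_zero m) w (HS2_fun V (t := X))]
    (HS2_zero (phase_seq e) (phase_measure m mhat))) => /=.
  apply: filterS (HS2_zero_ae (phase_seq e) (phase_measure m mhat)) => X -> a b.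
  by rewrite int0 hdot0l.
apply: filterS => X WX; apply/funext => a; apply: hdot_inj => b.
by rewrite WX int0 hdot0l.
Qed.

Hypothesis hF : ess_bounded_field (phase_seq e) (phase_measure m mhat) F.

Lemma bounded_opF X : bounded_op (F X).
Proof. by case: hF => bF _ _; exact: bF. Qed.

(** The field sought by [diagR] exists because [F] is essentially bounded; cyclicity of the trace
    then applies pointwise. *)
Lemma berezin_formE u v : berezin_form u v = HS2_dot (diagR F (W u)) (W v).
Proof.
have := xgetPex (HS2_zero (phase_seq e) (phase_measure m mhat))
  (HS2_comp_exists (W u) hF).
move=> dF; apply: ae_eq_cintegral; apply: filterS dF => X dFX.
rewrite -trace_mulC; [|exact: HS2_hs..|exact: bounded_opF].
by rewrite /diagR dFX.
Qed.

Lemma berezin_eq (B : L2 m -> L2 m) :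
  (forall u v, L2_dot (B u) v = berezin_form u v) ->
  berezin rep e mhat w F = B.
Proof.
move=> hB; rewrite /berezin; case: xgetP => [B' _ hB'|/(_ B)/(_ hB)//].
by apply/funext => u; apply: L2_dot_inj => v; rewrite hB hB'.
Qed.

Lemma berezin0 : berezin rep e mhat w F (L2_zero m) = L2_zero m.
Proof.
(* If no operator satisfies the defining identity, the default value is the constant zero. *)
rewrite /berezin; case: xgetP => [B _ hB|//]; apply: L2_dot_inj => v.
rewrite hB L2_dot0l -(cintegral0 (phase_measure m mhat)).
apply: ae_eq_cintegral; apply: filterS bargmann0 => X W0.
(* Cyclicity makes the Bargmann transform of 0 the outermost factor, so every diagonal coefficient
   is the scalar product of 0 with a basis vector. *)
rewrite -trace_mulC; [|exact: HS2_hs..|exact: bounded_opF].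
change (fourier_wigner rep e mhat (L2_zero m) w) with (W (L2_zero m)).
by rewrite W0; apply: trace_eq0 => n; rewrite hdot0l.
Qed.

End berezin_toeplitz.

Theorem proposition6p4 (R : realType) (G : topologicalGroupType)
    (hG : lcsc_group G) (hI : type_I R G)
    (m : {sigma_finite_measure set (borel G) -> \bar R})
    (hm : left_haar m) (hunimod : right_invariant m)
    (d : measure_display) (D : measurableType d) (sp : D -> hilbertType R)
    (rep : forall xi : D, unirep G (sp xi))
    (hdual : is_unitary_dual rep)
    (hmackey : forall A : set D, measurable A <-> mackey_measurable rep A)
    (e : nat -> forall xi : D, sp xi)
    (hfield : measurable_hilbert_field e)
    (hrep : forall x : G, measurable_opfield e (fun xi => rep xi x))
    (mhat : {sigma_finite_measure set D -> \bar R})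
    (hmhat : is_plancherel m rep e mhat)
    (w : L2 m)
    (F : forall X : D * borel G, sp X.1 -> sp X.1)
    (hF : ess_bounded_field (phase_seq e) (phase_measure m mhat) F) :
  toeplitz rep w F =
    bargmann_proj rep w \o diagR F \o bargmann_proj rep w
    :> (B22 m e mhat -> B22 m e mhat).
Proof.
rewrite /toeplitz /bargmann_proj /bargmann_adj; case: xgetP => [S _ hS|noS].
  rewrite (@berezin_eq _ _ _ _ _ _ rep e mhat w F
    (S \o diagR F \o bargmann rep e mhat w)) => // u v.
  (* [hS] has the adjoint in the second argument, the Berezin identity has the operator in the
     first; hence a conjugation on each side. *)
  transitivity (conjc (L2_dot v (S (diagR F (bargmann rep e mhat w u))))).
    rewrite /L2_dot -cintegral_conj; congr cintegral; apply/funext => x.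
    by rewrite rmorphM /= conjcK mulrC.
  by rewrite -hS -HS2_dotC berezin_formE.
by apply/funext => A /=; rewrite berezin0.
Qed.
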